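(* Given $i,k\in\mathbb N$ with $k\le i$, define for $t\in\mathbb C$ $$S_{i,k}(t):=\sum_{i_1+\cdots+i_k=i}(t-i_1+1)(t-i_1-i_2+1)\cdots(t-i+1),$$ where $i$ and $k$ are fixed and the sum runs over all $(i_1,\dots,i_k)\in\mathbb N^k$ with sum $i$. Then $$S_{i,k}(t)=(t-i+1)\cdot\sum_{l=0}^{k-1}s(i-1,l+i-k)\binom{l+i-k}{l}\,t^l,$$ where $s(\cdot,\cdot)$ are the Stirling numbers of the first kind.
   Context: The product in the definition of $S_{i,k}$ has $k$ factors $t-i_1-\cdots-i_q+1$, $q=1,\dots,k$. Here $s(n,l)$ are the signed Stirling numbers of the first kind: $y(y-1)\cdots(y-n+1)=\sum_{l=0}^ns(n,l)y^l$ (with $s(0,0)=1$). The convention $t^0=1$ is used. *)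

(* Defs.v *)
(* The complex numbers are R[i] for R : realType. *)
From mathcomp Require Import all_boot all_order all_algebra.
From mathcomp Require Import complex reals.

Set Implicit Arguments.
Unset Strict Implicit.
Unset Printing Implicit Defensive.

Import GRing.Theory.
Local Open Scope ring_scope.

(* Signed: the coefficient of y ^ l in y (y - 1) ... (y - n + 1). *)
Definition stirling1 (n l : nat) : int :=
  (\prod_(j < n) ('X - (j%:R)%:P) : {poly int})`_l.

(* Here the naturals start at 1, so the (i_1, ..., i_k) are k-tuples of
   positive integers of sum i. Such parts are at most i, hence the finite
   index type; i_q is [c] at the ordinal q - 1. *)
Definition is_composition (i k : nat) (c : {ffun 'I_k -> 'I_i.+1}) : bool :=
  [forall q, 0 < c q]%N && (\sum_(q < k) c q == i)%N.

Definition sumS (R : realType) (i k : nat) (t : R[i]) : R[i] :=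
  \sum_(c : {ffun 'I_k -> 'I_i.+1} | is_composition c)
    \prod_(q < k) (t - (\sum_(p < k | (p <= q)%N) (c p : nat)%:R) + 1).

(* Main.v *)
(* The partial sums of a composition of i into k parts are i together with a
   (k-1)-subset of {1, ..., i-1}, so S_{i,k}(t) is t - i + 1 times the
   elementary symmetric polynomial of degree k-1 in t, t-1, ..., t-(i-2). That
   is the coefficient of X^(i-k) in the falling factorial of X + t of length
   i-1, which is read off from the Stirling expansion in powers of X + t. *)
Require Import Defs.
From mathcomp Require Import all_boot all_order all_algebra.
From mathcomp Require Import complex reals.

Import GRing.Theory.
Local Open Scope ring_scope.

Section ElementarySymmetric.

Variables (C : comNzRingType) (t : C).

(** The elementary symmetric polynomial of degree [m] in t, t-1, ..., t-n+1, read off its generating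
    product. *)
Definition shifted_elem (n m : nat) : C :=
  (\prod_(j < n) (1 + (t - j%:R) *: 'X) : {poly C})`_m.

Lemma shifted_elem0r n : shifted_elem n 0 = 1.
Proof.
rewrite /shifted_elem; elim: n => [|n IHn]; first by rewrite big_ord0 coef1.
by rewrite big_ord_recr /= mulrDr mulr1 coefD -scalerAr coefZ coefMX mulr0 addr0.
Qed.

Lemma shifted_elemS n m :
  shifted_elem n.+1 m.+1 =
  shifted_elem n m.+1 + (t - n%:R) * shifted_elem n m.
Proof.
by rewrite /shifted_elem big_ord_recr /= mulrDr mulr1 coefD -scalerAr coefZ coefMX.
Qed.

Lemma shifted_elem_gt n m : (n < m)%N -> shifted_elem n m = 0.
Proof.
elim: n m => [|n IHn] [|m] // ltnm; first by rewrite /shifted_elem big_ord0 coef1.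
by rewrite shifted_elemS !IHn ?mulr0 ?addr0 // ltnW.
Qed.

(** Sorts the products by their largest chosen index [j]; this is the shape of the recursion on the
    last part of a composition. *)
Lemma shifted_elem_sum n m :
  shifted_elem n m.+1 = \sum_(j < n) (t - j%:R) * shifted_elem j m.
Proof.
elim: n => [|n IHn]; first by rewrite big_ord0 shifted_elem_gt.
by rewrite shifted_elemS big_ord_recr /= IHn.
Qed.

(** Taking 'X from [l] factors leaves [m] factors t-j; formally, both sides obey the same recursion
    in [n]. *)
Lemma coef_prod_shifted n l m : (l + m = n)%N ->
  (\prod_(j < n) ('X + (t - j%:R)%:P) : {poly C})`_l = shifted_elem n m.
Proof.
set P := fun n => \prod_(j < n) ('X + (t - j%:R)%:P).
have PS k : P k.+1 = P k * 'X + (t - k%:R) *: P k.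
  by rewrite /P big_ord_recr /= mulrDr [_ * _%:P]mulrC mul_polyC.
have P_gt k j : (k < j)%N -> (P k)`_j = 0.
  elim: k j => [|k IHk] [|j] // ltkj; first by rewrite /P big_ord0 coef1.
  rewrite PS coefD coefMX coefZ /= IHk // IHk; last exact: ltnW.
  by rewrite mulr0 addr0.
rewrite -/(P n); elim: n l m => [|n IHn] l m.
  by case: l m => [|[]] // [] // _; rewrite /P /shifted_elem !big_ord0.
rewrite PS coefD coefMX coefZ; case: m => [|m].
  rewrite addn0 => -> /=.
  by rewrite (P_gt n n.+1) // mulr0 addr0 (IHn _ 0) ?addn0 // !shifted_elem0r.
rewrite addnS => -[lmn]; rewrite shifted_elemS (IHn _ _ lmn); congr (_ + _).
(* For [l = 0] the 'X term contributes 0, and the right side is 0 because its degree [m.+1] exceeds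
   [n]. *)
case: l lmn => [|l] lmn /=; last by rewrite (IHn _ m.+1) // addnS.
by rewrite shifted_elem_gt // -lmn.
Qed.

(** The integer falling factorial that defines [stirling1], mapped to [C] and composed with X +
    t. *)
Lemma prod_shifted_stirling n :
  \prod_(j < n) ('X + (t - j%:R)%:P) =
  \sum_(m < n.+1) (stirling1 n m)%:~R *: ('X + t%:P) ^+ m.
Proof.
pose F : {poly int} := \prod_(j < n) ('X - (j%:R)%:P).
have szF : size F = n.+1.
  by rewrite /F size_prod_XsubC /index_enum -enumT size_enum_ord.
have -> : \prod_(j < n) ('X + (t - j%:R)%:P) =
    map_poly intr F \Po ('X + t%:P).
  rewrite /F rmorph_prod rmorph_prod; apply: eq_bigr => j _ /=.
  rewrite [map_poly _ _]rmorphB /= map_polyX map_polyC /= rmorph_nat.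
  by rewrite comp_polyB comp_polyX comp_polyC polyCB addrA.
pose G m := (map_poly intr F)`_m *: ('X + t%:P) ^+ m.
(* The sum runs up to the size of the mapped polynomial, which is at most [n.+1]; the terms added by
   widening have coefficient zero. *)
rewrite comp_polyE (big_ord_widen n.+1 G); last by rewrite -szF size_poly.
rewrite big_mkcond /=; apply: eq_bigr => m _.
rewrite /G coef_map /= -[F`_m]/(stirling1 n m); case: ltnP => // szm.
have := nth_default 0 szm; rewrite coef_map /= => ->.
by rewrite scale0r.
Qed.

(** Compares the coefficients of X^(n-m) in the two forms of the shifted falling factorial. *)
Lemma shifted_elem_stirling n m : (m <= n)%N ->
  shifted_elem n m =
  \sum_(l < m.+1)
     (stirling1 n (l + (n - m)))%:~R * ('C(l + (n - m), l))%:R * t ^+ l.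
Proof.
move=> lemn; rewrite -(coef_prod_shifted n (n - m) m) ?subnK //.
rewrite prod_shifted_stirling coef_sum.
have coefXt j l : (('X + t%:P) ^+ j)`_l = t ^+ (j - l) *+ 'C(j, l).
  rewrite addrC exprDn coef_sum.
  have [ltjl|lelj] := ltnP j l.
    rewrite bin_small // mulr0n big1 // => -[p ltp] _ /=.
    rewrite coefMn -polyC_exp coefCM coefXn gtn_eqF ?mulr0 ?mul0rn //.
    exact: leq_ltn_trans ltjl.
  rewrite (bigD1 (Ordinal (lelj : l < j.+1)%N)) //= big1 ?addr0 => [|p npl].
    by rewrite coefMn -polyC_exp coefCM coefXn eqxx mulr1.
  rewrite coefMn -polyC_exp coefCM coefXn eq_sym.
  by rewrite (negPf (npl : (p : nat) != l)) mulr0 mul0rn.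
pose G j := (stirling1 n j)%:~R * (t ^+ (j - (n - m)) *+ 'C(j, n - m)).
transitivity (\sum_(0 <= j < n.+1) G j).
  by rewrite big_mkord; apply: eq_bigr => j _; rewrite coefZ coefXt.
(* Powers [j] below [n - m] have zero binomial coefficient; the others are reindexed as
   [j = l + (n - m)]. *)
rewrite (@big_cat_nat _ _ _ (n - m)) ?leqW ?leq_subr //=.
rewrite big_nat big1 ?add0r => [|j /andP[_ ltj]]; last first.
  by rewrite /G bin_small // mulr0n mulr0.
rewrite -[X in \sum_(X <= _ < _) _]add0n big_addn subSn ?leq_subr // subKn //.
rewrite big_mkord; apply: eq_bigr => l _.
rewrite /G addnK -[X in 'C(_, X)](addKn l (n - m)%N) bin_sub ?leq_addr //.
by rewrite -mulrA mulr_natl.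
Qed.

End ElementarySymmetric.

Section Compositions.

Variables (C : comNzRingType) (t : C) (N : nat).

(* Bounding the parts by an N that does not depend on i makes the recursion on
   the last part type-check. *)
Definition bounded_sum (i k : nat) : C :=
  \sum_(c : {ffun 'I_k -> 'I_N} |
        [forall q, 0 < c q]%N && (\sum_(q < k) c q == i)%N)
    \prod_(q < k) (t - (\sum_(p < k | (p <= q)%N) (c p : nat)%:R) + 1).

Lemma bounded_sum0 i : bounded_sum i 0 = (i == 0)%:R.
Proof.
rewrite /bounded_sum.
under eq_bigr do rewrite big_ord0.
under eq_bigl do rewrite big_ord0 [0%N == i]eq_sym.
case: (i == 0)%N; last by rewrite big1 // => c; rewrite andbF.
rewrite (eq_bigl predT) => [|c]; last by rewrite andbT; apply/forallP => -[].
by rewrite sumr_const card_ffun !card_ord expn0.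
Qed.

(** The default value [ca.2] of [oapp] is reached exactly at [ord_max]. *)
Definition ffun_rcons k (ca : {ffun 'I_k -> 'I_N} * 'I_N) :
    {ffun 'I_k.+1 -> 'I_N} :=
  [ffun q => oapp ca.1 ca.2 (unlift ord_max q)].

Lemma ffun_rcons_max k ca : @ffun_rcons k ca ord_max = ca.2.
Proof. by rewrite ffunE unlift_none. Qed.

Lemma ffun_rcons_widen k ca (q : 'I_k) :
  ffun_rcons k ca (widen_ord (leqnSn k) q) = ca.1 q.
Proof.
have -> : widen_ord (leqnSn k) q = lift ord_max q.
  by apply: val_inj; rewrite [RHS]lift_max.
by rewrite ffunE liftK.
Qed.

Lemma ffun_rcons_bij k : bijective (ffun_rcons k).
Proof.
exists (fun c : {ffun 'I_k.+1 -> 'I_N} =>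
  ([ffun q => c (widen_ord (leqnSn k) q)], c ord_max)) => [[c a]|c].
  rewrite ffun_rcons_max; congr pair; apply/ffunP => q.
  by rewrite ffunE ffun_rcons_widen.
apply/ffunP => q; have [p ->|->] := unliftP ord_max q.
  rewrite ffunE liftK /= ffunE; congr (c _); apply: val_inj.
  by rewrite [RHS]lift_max.
by rewrite ffun_rcons_max.
Qed.

(** The last partial sum is always [i], so its factor comes out; dropping the last part leaves a
    composition of some [j < i]. The bound [i < N] lets the dropped part [i - j] fit in ['I_N]. *)
Lemma bounded_sumS i k : (i < N)%N ->
  bounded_sum i k.+1 = (t - i%:R + 1) * \sum_(j < i) bounded_sum j k.
Proof.
move=> ltiN; rewrite /bounded_sum (reindex _ (onW_bij _ (ffun_rcons_bij k))) /=.
pose W (c : {ffun 'I_k -> 'I_N}) : C :=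
  \prod_(q < k) (t - (\sum_(p < k | (p <= q)%N) (c p : nat)%:R) + 1).
pose pos (c : {ffun 'I_k -> 'I_N}) := [forall q, 0 < c q]%N.
pose s (c : {ffun 'I_k -> 'I_N}) := (\sum_(q < k) c q)%N.
have sumE ca : (\sum_(q < k.+1) ffun_rcons k ca q = s ca.1 + ca.2)%N.
  rewrite big_ord_recr ffun_rcons_max; congr (_ + _)%N.
  by apply: eq_bigr => q _; rewrite ffun_rcons_widen.
have posE ca : [forall q, 0 < ffun_rcons k ca q]%N = pos ca.1 && (0 < ca.2)%N.
  apply/forallP/andP => [H|[/forallP Hc Ha] q].
    split; last by rewrite -(ffun_rcons_max k ca).
    by apply/forallP => q; rewrite -ffun_rcons_widen.
  by rewrite ffunE; case: unliftP => [p|] _ /=.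
transitivity (\sum_(ca : {ffun 'I_k -> 'I_N} * 'I_N |
    pos ca.1 && ((0 < ca.2) && (s ca.1 + ca.2 == i))%N)
    ((t - i%:R + 1) * W ca.1)).
  apply: eq_big => [ca|ca]; rewrite posE sumE ?andbA // => /andP[_ /eqP sumi].
  rewrite big_ord_recr [RHS]mulrC; congr (_ * _).
    apply: eq_bigr => q _; congr (_ - _ + _).
    rewrite big_mkcond big_ord_recr /= leqNgt ltn_ord addr0 [RHS]big_mkcond.
    by apply: eq_bigr => p _; rewrite ffun_rcons_widen.
  congr (_ - _ + _); rewrite -sumi -sumE natr_sum; apply: eq_bigl => p.
  by rewrite -ltnS ltn_ord.
rewrite -big_distrr; congr (_ * _).
rewrite -(pair_big_dep pos (fun c (a : 'I_N) => (0 < a) && (s c + a == i))%N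
  (fun c _ => W c)) /=.
transitivity (\sum_(c | pos c) \sum_(j < i | s c == j) W c); last first.
  rewrite (exchange_big_dep predT) //=.
(* For fixed [c] each inner sum has one term if [s c < i], namely [a = i - s c] and [j = s c]
   respectively, and none otherwise. *)
apply: eq_bigr => c _; have [ltsi|leis] := ltnP (s c) i.
  have lta : (i - s c < N)%N by apply: leq_ltn_trans ltiN; apply: leq_subr.
  rewrite (big_pred1 (Ordinal lta)) => [|a]; last first.
    apply/andP/eqP => [[_ /eqP sai]|->].
      by apply: val_inj; rewrite /= -sai addKn.
    by rewrite subn_gt0 ltsi subnKC // ltnW.
  by rewrite (big_pred1 (Ordinal ltsi)) // => j; rewrite /= eq_sym.
rewrite !big1 // => [j /eqP sj|a /andP[a_gt0 /eqP sai]].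
  by have := ltn_ord j; rewrite -sj ltnNge leis.
by move: leis; rewrite -sai -{2}[s c]addn0 leq_add2l leqNgt a_gt0.
Qed.

(** Induction on [k]: [bounded_sumS] and [shifted_elem_sum] are the same recursion up to a shift of
    [j] by one. *)
Lemma bounded_sum_elem i k : (i.+1 < N)%N ->
  bounded_sum i.+1 k.+1 = (t - i%:R) * shifted_elem _ t i k.
Proof.
elim: k i => [|k IHk] i ltiN; rewrite bounded_sumS // -natr1 opprD addrA subrK.
  rewrite big_ord_recl bounded_sum0 shifted_elem0r big1 ?addr0 // => j _.
  by rewrite bounded_sum0.
(* The term [j = 0] vanishes, since 0 has no composition into [k.+1] positive parts. *)
rewrite shifted_elem_sum big_ord_recl bounded_sumS; last exact: ltn_trans ltiN.
rewrite big_ord0 mulr0 add0r; congr (_ * _); apply: eq_bigr => j _.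
by apply: IHk; apply: leq_ltn_trans ltiN; rewrite ltnS; apply: ltnW.
Qed.

End Compositions.

Theorem corollary6p13 (R : realType) (i k : nat)
    (hk : (1 <= k)%N) (hki : (k <= i)%N) (t : R[i]) :
  sumS i k t =
    (t - i%:R + 1) *
      \sum_(l < k)
        (stirling1 (i - 1) (l + i - k))%:~R * ('C(l + i - k, l))%:R * t ^+ l.
Proof.
case: k hk hki => // k _; case: i => // i leki.
(* With [i] now the predecessor of the original index, [sumS] is by definition [bounded_sum] at
   [N = i.+2]. *)
rewrite -[sumS _ _ _]/(bounded_sum _ t i.+2 i.+1 k.+1) bounded_sum_elem //.
rewrite -natr1 opprD addrA subrK shifted_elem_stirling // subn1 /=.
congr (_ * _); apply: eq_bigr => l _.
by rewrite addnS subSS addnBA.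
Qed.
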